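(* For a small category $\mathcal C$, the following are equivalent: (a) $\mathcal C$ satisfies the axioms (A1)–(A9) and is pointed; (b) $\mathcal C$ satisfies (A1)–(A9) and every derived label $\phi\in\Phi$ has arity one; (c) $\mathcal C$ is isomorphic to the word category $\mathcal W_L$ for some set $L$. These conditions are also equivalent, among categories satisfying the nine axioms, to every operation of the recovered operad having arity one. The alphabet $L$ can be recovered as the derived label set $\Phi$, or equivalently as the set of objects of complexity one. Under this representation, complexity is word length.
   Context: AXIOMS. Let $\mathcal C$ be a small category. A monomorphism $m:A\to B$ is strong if for every epimorphism $e:P\to Q$ and all $a:P\to A$, $b:Q\to B$ with $ma=be$ there is $\ell:Q\to A$ with $\ell e=a$ and $m\ell=b$. The nine axioms are: (A1) There is a terminal object $1$ (fixed); $q_X:X\to 1$ is the unique morphism, and a point of $Y$ is a morphism $1\to Y$. (A2) Every morphism factors as $me$ with $e$ an epimorphism and $m$ a strong monomorphism. (A3) For every epimorphism $d:X\to Y$ and strong monomorphism $v:B\to Y$ the pullback of $d$ and $v$ exists and its projection to $B$ is an epimorphism. (A4) For every strong monomorphism $u:A\to X$ and epimorphism $a:A\to B$ there is a pushout square $cu=va$ ($c:X\to Y$, $v:B\to Y$) with $v$ a strong monomorphism, and this square is also a pullback. (A5) The class of epimorphisms whose pullbacks along all but at most one point of their codomain are isomorphisms is stable under pushout along strong monomorphisms. (A6) For every object $A$ and point $j:1\to B$ the category $\mathcal F(A,j)$ has a terminal object. Its objects are triples $(C,d,u)$ with $u:A\to C$ a strong monomorphism and $d:C\to B$ an epimorphism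 such that the square $du=jq_A$ is a pullback; its morphisms $(C',d',u')\to(C,d,u)$ are morphisms $h:C'\to C$ with $hu'=u$ and $dh=d'$. (A7) For every object $X$ there are finitely many strong monomorphisms with codomain $X$ and finitely many epimorphisms with domain $X$ (counted as individual arrows, with all possible other endpoints). (A8) For every commutative square of strong monomorphisms $ca=db$ ($a:W\to X$, $b:W\to Y$, $c:X\to Z$, $d:Y\to Z$) there is $h:X\to Y$ with $ha=b$, $dh=c$, or there is $k:Y\to X$ with $kb=a$, $ck=d$. (A9) If the pullback of an epimorphism $d:X\to Y$ along every point of $Y$ is an isomorphism, then $d$ is an identity. Here ''the pullback of $d$ along a point $j:1\to Y$'' is the projection $X\times_Y1\to1$. NOTATION. A category is pointed if it has an object that is both initial and terminal. The following is for $\mathcal C$ satisfying the nine axioms. The complexity of $X$ is $c(X)=|\mathrm S(X)|-1$, where $\mathrm S(X)$ is the set of all strong monomorphisms with codomain $X$ (so $c(X)$ counts the nonidentity ones). A strong monomorphism $i:A\to X$ is indecomposable if it is not an identity and whenever $i=vu$ with $u,v$ strong monomorphisms, $u$ or $v$ is an identity; $\operatorname{Comp}(X)$ is the set of indecomposable strong monomorphisms into $X$. Let $\mathcal E^\circ$ consist of the epimorphisms with codomain $\neq 1$ together with $\mathrm{id}_1$; an object is normal if its only outgoing morphism in $\mathcal E^\circ$ is its identity. The derived labels $\phi\in\Phi$ are the normal objects $\ne1$, and the arity of $\phi$ is $|\operatorname{Comp}(\phi)|$. The recovered operad is the free non-symmetric operad on $\Phi$ whose operations of arity $n$ are the objects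 of $\mathcal C$ with exactly $n$ points (composition being insertion of objects at points). WORD CATEGORIES. For a set $L$ (alphabet), $\mathcal W_L$ has as objects the finite words over $L$, including the empty word. For words $u,v$, \[\mathcal W_L(u,v)=\{f^r_{u,v}: 0\le r\le\min(|u|,|v|),\ \operatorname{pre}_r(u)=\operatorname{suf}_r(v)\},\] where $\operatorname{pre}_r(u)$ and $\operatorname{suf}_r(v)$ are the prefix of $u$ and the suffix of $v$ of length $r$; the identity of $u$ is $f^{|u|}_{u,u}$ and composition is $f^s_{v,w}f^r_{u,v}=f^{\max(0,r+s-|v|)}_{u,w}$. *)

(* Defs.v *)
From mathcomp Require Import all_boot finmap.
From mathcomp Require Import boolp classical_sets functions cardinality.
From mathcomp Require Import zify.

Set Implicit Arguments.
Unset Strict Implicit.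
Unset Printing Implicit Defensive.

Local Open Scope classical_set_scope.

Declare Scope cat_scope.
Delimit Scope cat_scope with cat.
Local Open Scope cat_scope.

(* For an infinite set, fset_set is empty and the value is 0; in a category
   satisfying nine_axioms the sets counted below are finite. *)
Definition ncard (T : Type) (A : set T) : nat :=
  #|` fset_set (A : set {classic T}) |.

Record category := Category {
  obj :> Type;
  hom : obj -> obj -> Type;
  idm : forall X, hom X X;
  ccomp : forall X Y Z, hom Y Z -> hom X Y -> hom X Z;
  ccomp1m : forall X Y (f : hom X Y), ccomp (idm Y) f = f;
  ccompm1 : forall X Y (f : hom X Y), ccomp f (idm X) = f;
  ccompA : forall W X Y Z (h : hom Y Z) (g : hom X Y) (f : hom W X),
    ccomp h (ccomp g f) = ccomp (ccomp h g) f }.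

Notation "g ∘ f" := (ccomp g f) (at level 40, left associativity) : cat_scope.

(* Arrows with their endpoints, so that arrows between objects that are only
   propositionally equal can be compared. *)
Definition arrow (C : category) := {X : C & {Y : C & hom X Y}}.
Definition arr (C : category) (X Y : C) (f : hom X Y) : arrow C :=
  existT _ X (existT _ Y f).

Record functor (C D : category) := Functor {
  fobj :> C -> D;
  fmap : forall X Y : C, hom X Y -> hom (fobj X) (fobj Y);
  fmap1 : forall X : C, fmap (idm X) = idm (fobj X);
  fmapM : forall (X Y Z : C) (g : hom Y Z) (f : hom X Y),
    fmap (g ∘ f) = fmap g ∘ fmap f }.

(* Strict isomorphisms of categories; equality on identity arrows gives the
   equality on objects. *)
Record cat_iso (C D : category) := CatIso {
  iso_fun :> functor C D;
  iso_inv : functor D C;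
  iso_funK : forall (X Y : C) (f : hom X Y),
    arr (fmap iso_inv (fmap iso_fun f)) = arr f;
  iso_invK : forall (X Y : D) (f : hom X Y),
    arr (fmap iso_fun (fmap iso_inv f)) = arr f }.

Definition isomorphic (C D : category) : Prop := inhabited (cat_iso C D).

Section Morphisms.
Variable C : category.
Implicit Types W X Y Z A B P Q : C.

Definition mono A B (m : hom A B) : Prop :=
  forall P (f g : hom P A), m ∘ f = m ∘ g -> f = g.

Definition epi P Q (e : hom P Q) : Prop :=
  forall Y (f g : hom Q Y), f ∘ e = g ∘ e -> f = g.

Definition strong_mono A B (m : hom A B) : Prop :=
  mono m /\
  forall P Q (e : hom P Q), epi e ->
  forall (a : hom P A) (b : hom Q B), m ∘ a = b ∘ e ->
  exists l : hom Q A, l ∘ e = a /\ m ∘ l = b.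

Definition is_iso X Y (f : hom X Y) : Prop :=
  exists g : hom Y X, g ∘ f = idm X /\ f ∘ g = idm Y.

Inductive is_identity : forall X Y, hom X Y -> Prop :=
  IsIdentity X : is_identity (idm X).

Definition is_pullback P X B Y
    (p : hom P X) (q : hom P B) (f : hom X Y) (g : hom B Y) : Prop :=
  f ∘ p = g ∘ q /\
  forall Q (x : hom Q X) (b : hom Q B), f ∘ x = g ∘ b ->
  exists! h : hom Q P, p ∘ h = x /\ q ∘ h = b.

Definition is_pushout A X B Y
    (u : hom A X) (a : hom A B) (c : hom X Y) (v : hom B Y) : Prop :=
  c ∘ u = v ∘ a /\
  forall Z (x : hom X Z) (b : hom B Z), x ∘ u = b ∘ a ->
  exists! h : hom Y Z, h ∘ c = x /\ h ∘ v = b.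

Definition is_initial X : Prop :=
  forall Y, exists f : hom X Y, forall g : hom X Y, g = f.

Definition is_terminal Y : Prop :=
  forall X, exists f : hom X Y, forall g : hom X Y, g = f.

Definition pointed : Prop := exists X, is_initial X /\ is_terminal X.

Record terminal_object := TerminalObject {
  one :> C;
  bang : forall X, hom X one;
  bang_unique : forall X (f : hom X one), f = bang X }.

End Morphisms.

Section InsertionCategory.
Variables (C : category) (t : terminal_object C) (A B : C) (j : hom t B).

Record ins_obj := InsObj {
  ins_C : C;
  ins_d : hom ins_C B;
  ins_u : hom A ins_C;
  ins_u_strong : strong_mono ins_u;
  ins_d_epi : epi ins_d;
  ins_pullback : is_pullback ins_u (bang t A) ins_d j }.

Record ins_hom (S T : ins_obj) := InsHom {
  ins_h : hom (ins_C S) (ins_C T);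
  ins_hu : ins_h ∘ ins_u S = ins_u T;
  ins_dh : ins_d T ∘ ins_h = ins_d S }.

Lemma ins_hom_eq S T (f g : ins_hom S T) : ins_h f = ins_h g -> f = g.
Proof.
case: f g => [f fu fd] [g gu gd] /= fg; subst g.
by rewrite (Prop_irrelevance fu gu) (Prop_irrelevance fd gd).
Qed.

Definition ins_id (S : ins_obj) : ins_hom S S :=
  InsHom (ccomp1m (ins_u S)) (ccompm1 (ins_d S)).

Lemma ins_comp_u S T U (g : ins_hom T U) (f : ins_hom S T) :
  (ins_h g ∘ ins_h f) ∘ ins_u S = ins_u U.
Proof. by rewrite -ccompA !ins_hu. Qed.

Lemma ins_comp_d S T U (g : ins_hom T U) (f : ins_hom S T) :
  ins_d U ∘ (ins_h g ∘ ins_h f) = ins_d S.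
Proof. by rewrite ccompA !ins_dh. Qed.

Definition ins_comp S T U (g : ins_hom T U) (f : ins_hom S T) : ins_hom S U :=
  InsHom (ins_comp_u g f) (ins_comp_d g f).

Definition ins_category : category.
Proof.
by refine (@Category ins_obj ins_hom ins_id ins_comp _ _ _) => *;
  apply: ins_hom_eq; rewrite /= ?ccomp1m ?ccompm1 ?ccompA.
Defined.

End InsertionCategory.

Section NineConditions.
Variables (C : category) (t : terminal_object C).
Implicit Types W X Y Z A B : C.

Definition point_of Y := hom t Y.

(* By A3 below the pullback exists for every epimorphism d: points are split,
   hence strong, monomorphisms. *)
Definition iso_over X Y (d : hom X Y) (j : point_of Y) : Prop :=
  exists P (p : hom P X) (q : hom P t), is_pullback p q d j /\ is_iso q.

Definition epi_iso_off_one_point X Y (d : hom X Y) : Prop :=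
  epi d /\
  forall j k : point_of Y, ~ iso_over d j -> ~ iso_over d k -> j = k.

Definition strong_monos_into X : set {A : C & hom A X} :=
  [set s : {A : C & hom A X} | strong_mono (projT2 s)].

Definition epis_from X : set {Y : C & hom X Y} :=
  [set s : {Y : C & hom X Y} | epi (projT2 s)].

(* The first axiom, a fixed terminal object, is the variable t. *)
Record nine_axioms : Prop := NineAxioms {
  A2 : forall X Y (f : hom X Y),
    exists I (e : hom X I) (m : hom I Y),
      [/\ epi e, strong_mono m & f = m ∘ e];
  A3 : forall X Y B (d : hom X Y) (v : hom B Y), epi d -> strong_mono v ->
    exists P (p : hom P X) (q : hom P B), is_pullback p q d v /\ epi q;
  A4 : forall A X B (u : hom A X) (a : hom A B), strong_mono u -> epi a ->
    exists Y (c : hom X Y) (v : hom B Y),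
      [/\ is_pushout u a c v, strong_mono v & is_pullback u a c v];
  A5 : forall A X B Y
      (u : hom A X) (a : hom A B) (c : hom X Y) (v : hom B Y),
    strong_mono u -> epi_iso_off_one_point a -> is_pushout u a c v ->
    epi_iso_off_one_point c;
  A6 : forall A B (j : point_of B), inhabited (terminal_object (ins_category A j));
  A7 : forall X,
    finite_set (@strong_monos_into X) /\ finite_set (@epis_from X);
  A8 : forall W X Y Z
      (a : hom W X) (b : hom W Y) (c : hom X Z) (d : hom Y Z),
    strong_mono a -> strong_mono b -> strong_mono c -> strong_mono d ->
    c ∘ a = d ∘ b ->
    (exists h : hom X Y, h ∘ a = b /\ d ∘ h = c) \/
    (exists k : hom Y X, k ∘ b = a /\ c ∘ k = d);
  A9 : forall X Y (d : hom X Y), epi d ->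
    (forall j : point_of Y, iso_over d j) -> is_identity d }.

Definition complexity X : nat := ncard (@strong_monos_into X) - 1.

Definition indecomposable A X (i : hom A X) : Prop :=
  [/\ strong_mono i, ~ is_identity i &
    forall B (v : hom B X) (u : hom A B), strong_mono u -> strong_mono v ->
      i = v ∘ u -> is_identity u \/ is_identity v].

Definition Comp X : set {A : C & hom A X} :=
  [set s : {A : C & hom A X} | indecomposable (projT2 s)].

Definition arity X : nat := ncard (@Comp X).

Definition Ecirc X Y (f : hom X Y) : Prop :=
  (epi f /\ Y <> t) \/ (is_identity f /\ Y = t).

Definition normal_object X : Prop :=
  forall Y (f : hom X Y), Ecirc f -> is_identity f.

Definition is_derived_label X : Prop := normal_object X /\ X <> t.

Definition derived_label : Type := {X : C | is_derived_label X}.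

Definition label_arity (phi : derived_label) : nat := arity (proj1_sig phi).

(* The operations of arity n of the recovered operad. *)
Definition operation (n : nat) : Type :=
  {X : C | [set: point_of X] #= `I_n}%card.

End NineConditions.

(* Operations of the free non-symmetric operad: planar trees with vertices
   labelled in Phi, graded by their number of leaves. *)
Inductive free_operation (Phi : Type) (ar : Phi -> nat) : nat -> Type :=
| FreeUnit : free_operation ar 1
| FreeGraft (phi : Phi) (n : 'I_(ar phi) -> nat)
    (x : forall i, free_operation ar (n i)) :
    free_operation ar (\sum_(i < ar phi) n i).

Section Words.
Variable L : Type.
Implicit Types u v w : seq L.

Definition pre (r : nat) u := take r u.
Definition suf (r : nat) u := drop (size u - r) u.

(* The morphism f^r_{u,v}, with r = overlap. *)
Record word_hom u v := WordHom {
  overlap : nat;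
  overlap_le : overlap <= minn (size u) (size v);
  overlap_eq : pre overlap u = suf overlap v }.

Lemma word_hom_eq u v (f g : word_hom u v) : overlap f = overlap g -> f = g.
Proof.
case: f g => [r r1 r2] [s s1 s2] /= rs; subst s.
by rewrite (Prop_irrelevance r1 s1) (Prop_irrelevance r2 s2).
Qed.

Lemma word_id_subproof u :
  (size u <= minn (size u) (size u)) /\ pre (size u) u = suf (size u) u.
Proof. by rewrite minnn /pre /suf subnn drop0 take_size. Qed.

Definition word_id u : word_hom u u :=
  WordHom (proj1 (word_id_subproof u)) (proj2 (word_id_subproof u)).

Lemma word_comp_le u v w (g : word_hom v w) (f : word_hom u v) :
  overlap f + overlap g - size v <= minn (size u) (size w).
Proof. by case: f g => [r r1 _] [s s1 _] /=; lia. Qed.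

Lemma word_comp_eq u v w (g : word_hom v w) (f : word_hom u v) :
  pre (overlap f + overlap g - size v) u
  = suf (overlap f + overlap g - size v) w.
Proof.
case: f g => [r r1 r2] [s s1 s2] /=; rewrite /pre /suf in r2 s2 *.
case: (leqP (r + s) (size v)) => rs.
  have -> : r + s - size v = 0 by lia.
  by rewrite take0 subn0 drop_size.
have -> : take (r + s - size v) u = take (r + s - size v) (take r u).
  by rewrite take_takel //; lia.
have -> : drop (size w - (r + s - size v)) w
          = drop (size v - r) (drop (size w - s) w).
  by rewrite drop_drop; congr drop; lia.
rewrite r2 -s2 take_drop; congr (drop _ (take _ _)).
lia.
Qed.

(* Truncated subtraction on nat is max(0, r + s - |v|). *)
Definition word_comp u v w (g : word_hom v w) (f : word_hom u v) :
    word_hom u w :=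
  WordHom (word_comp_le g f) (word_comp_eq g f).

Definition word_category : category.
Proof.
refine (@Category (seq L) word_hom word_id word_comp _ _ _).
- by move=> u v f; apply: word_hom_eq; have /= := overlap_le f; lia.
- by move=> u v f; apply: word_hom_eq; have /= := overlap_le f; lia.
- move=> u v w x h g f; apply: word_hom_eq => /=.
  by move: (overlap_le h) (overlap_le g) (overlap_le f); lia.
Defined.

End Words.

(* Main.v *)
Require Import Defs.
From mathcomp Require Import all_boot finmap.
From mathcomp Require Import boolp classical_sets functions cardinality.
From mathcomp Require Import zify.

(* In a pointed category with the nine axioms isomorphisms are identities, every
   strong monomorphism is the kernel of its cokernel and every epimorphism the
   cokernel of its kernel.  A morphism of extensions A -> X -> B has trivial
   kernel and cokernel, hence is an identity, so the terminal extension given by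
   A6 is the only one: X is determined by A and B.  An object other than 1 has
   exactly one quotient that is a derived label, because the strong subobjects
   of an object form a chain; splitting such quotients off repeatedly spells a
   word, extensions become concatenation, and a morphism is determined by the
   length of its image.
     If all derived labels have arity one, their points, which are their
   indecomposable strong subobjects, are unique; induction on complexity along
   the fibre of a label quotient shows that every object has exactly one point. *)

Set Implicit Arguments.
Unset Strict Implicit.
Unset Printing Implicit Defensive.

Local Open Scope classical_set_scope.
Local Open Scope cat_scope.

(** * Strong monomorphisms and epimorphisms *)

Lemma ncard_II (T : Type) (A : set T) n : (A #= `I_n)%card -> ncard A = n.
Proof. by move=> h; apply: card_fset_set. Qed.

Lemma finite_inj (T U : Type) (A : set T) (B : set U) (f : T -> U) :
    finite_set B -> {in A &, injective f} -> (forall x, A x -> B (f x)) ->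
  finite_set A.
Proof.
move=> finB injf AB; apply/finite_set_leP.
have /finite_set_leP [n le_n] : finite_set (f @` A).
  by apply: sub_finite_set finB => _ [x Ax <-]; apply: AB.
exists n; apply: card_le_trans le_n.
by have /card_eqPle[] := inj_card_eq injf.
Qed.

(** Turns the numbers of quotients and of strong subobjects into induction measures: composition
    with a nonidentity arrow embeds one set of arrows in another and misses the identity, which
    plays the part of [b]. *)
Lemma ncard_lt (T U : Type) (A : set T) (B : set U) (f : T -> U) (b : U) :
    finite_set B -> injective f -> (forall x, A x -> B (f x)) ->
    B b -> (forall x, A x -> f x <> b) -> ncard A < ncard B.
Proof.
move=> finB injf subAB Bb fNb.
pose f' : {classic T} -> {classic U} := f.
have sub : f' @` A `<=` B by move=> _ [x Ax <-]; apply: subAB.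
have finA : finite_set (A : set {classic T}).
  by apply: (finite_inj finB _ subAB) => x y _ _; apply: injf.
have -> : ncard A = #|` fset_set (f' @` A)|.
  by rewrite (@fset_set_image {classic T} {classic U} f' A finA) card_imfset.
have finfA : finite_set (f' @` A) by apply: sub_finite_set sub finB.
apply: fproper_ltn_card; rewrite fproperEneq; apply/andP; split; last first.
  by rewrite -fset_set_sub.
apply/eqP => /(fset_set_inj finfA finB) fAB.
have : (f' @` A) b by rewrite fAB.
by move=> [x Ax] /(fNb _ Ax).
Qed.

Lemma existT_inj2 T (P : T -> Type) (x : T) (p q : P x) :
  existT P x p = existT P x q -> p = q.
Proof.
move=> e; have := projT2_eq e.
by rewrite (Prop_irrelevance (projT1_eq e) (erefl x)).
Qed.

Section Categories.
Variable C : category.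
Implicit Types W X Y Z A B P Q : C.

Lemma arr_inj X Y (f g : hom X Y) : arr f = arr g -> f = g.
Proof. by move=> h; exact: existT_inj2 (existT_inj2 h). Qed.

Lemma arr_dom X Y X' Y' (f : hom X Y) (g : hom X' Y') : arr f = arr g -> X = X'.
Proof. by move=> /(congr1 (@projT1 _ _)). Qed.

Lemma arr_cod X Y X' Y' (f : hom X Y) (g : hom X' Y') : arr f = arr g -> Y = Y'.
Proof. by move=> /(congr1 (fun s => projT1 (projT2 s))). Qed.

Lemma identity_eq X Y (f : hom X Y) : is_identity f -> X = Y.
Proof. by case. Qed.

Lemma identity_idm X (f : hom X X) : is_identity f -> f = idm X.
Proof.
suff arr_id Y Z (g : hom Y Z) : is_identity g -> exists W, arr g = arr (idm W).
  by move=> /arr_id [Z e]; have XZ := arr_dom e; subst Z; apply: arr_inj.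
by case=> W; exists W.
Qed.

Lemma arr_identity_compl W X Y (h : hom X Y) (f : hom W X) :
  is_identity h -> arr (h ∘ f) = arr f.
Proof.
by move=> idh; have XY := identity_eq idh; subst Y; rewrite (identity_idm idh) ccomp1m.
Qed.

Lemma arr_identity_compr X Y Z (g : hom Y Z) (h : hom X Y) :
  is_identity h -> arr (g ∘ h) = arr g.
Proof.
by move=> idh; have XY := identity_eq idh; subst Y; rewrite (identity_idm idh) ccompm1.
Qed.

Lemma idm_iso X : is_iso (idm X).
Proof. by exists (idm X); rewrite ccomp1m. Qed.

Lemma iso_epi X Y (f : hom X Y) : is_iso f -> epi f.
Proof.
by move=> [g [_ fg]] Z x y e; rewrite -[x]ccompm1 -[y]ccompm1 -fg !ccompA e.
Qed.

Lemma iso_strong X Y (f : hom X Y) : is_iso f -> strong_mono f.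
Proof.
move=> [g [gf fg]]; split=> [Z x y e|P Q e _ a b ab].
  by rewrite -[x]ccomp1m -[y]ccomp1m -gf -!ccompA e.
by exists (g ∘ b); rewrite -ccompA -ab !ccompA gf fg !ccomp1m.
Qed.

Lemma epi_comp X Y Z (g : hom Y Z) (f : hom X Y) : epi g -> epi f -> epi (g ∘ f).
Proof. by move=> eg ef W x y; rewrite !ccompA => /ef/eg. Qed.

Lemma epi_of_comp X Y Z (g : hom Y Z) (f : hom X Y) : epi (g ∘ f) -> epi g.
Proof. by move=> h W x y e; apply: h; rewrite !ccompA e. Qed.

Lemma strong_comp X Y Z (g : hom Y Z) (f : hom X Y) :
  strong_mono g -> strong_mono f -> strong_mono (g ∘ f).
Proof.
move=> [mg sg] [mf sf]; split=> [W x y|P Q e ee a b ab].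
  by rewrite -!ccompA => /mg/mf.
have [l [le gl]] := sg _ _ e ee (f ∘ a) b (etrans (ccompA _ _ _) ab).
have [k [ke fk]] := sf _ _ e ee a l (esym le).
by exists k; rewrite -ccompA fk.
Qed.

Lemma strong_of_comp X Y Z (g : hom Y Z) (f : hom X Y) :
  strong_mono (g ∘ f) -> strong_mono g -> strong_mono f.
Proof.
move=> [mgf sgf] [mg _]; split=> [W x y e|P Q e ee a b ab].
  by apply: mgf; rewrite -!ccompA e.
have [|l [le gl]] := sgf _ _ e ee a (g ∘ b); first by rewrite -!ccompA ab.
by exists l; split=> //; apply: mg; rewrite ccompA.
Qed.

Lemma strong_pullback P X B Y (p : hom P X) (q : hom P B) (d : hom X Y)
    (v : hom B Y) : is_pullback p q d v -> strong_mono v -> strong_mono p.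
Proof.
move=> [sq uni] [mv sv].
have cancel_p Z (x y : hom Z P) : p ∘ x = p ∘ y -> x = y.
  move=> e; have e' : q ∘ x = q ∘ y by apply: mv; rewrite !ccompA -sq -!ccompA e.
  have [|h [_ hu]] := uni _ (p ∘ x) (q ∘ x); first by rewrite !ccompA sq.
  by rewrite -(hu x) // -(hu y).
split=> // R Q e ee a b ab.
have [|l [le vl]] := sv _ _ e ee (q ∘ a) (d ∘ b).
  by rewrite ccompA -sq -!ccompA ab.
have [h [[ph qh] _]] := uni _ b l (esym vl).
by exists h; split=> //; apply: cancel_p; rewrite ccompA ph.
Qed.

Lemma pushout_epi A X B Y (u : hom A X) (a : hom A B) (c : hom X Y)
    (v : hom B Y) : is_pushout u a c v -> epi a -> epi c.
Proof.
move=> [sq uni] ea Z f g fg.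
have fgv : f ∘ v = g ∘ v by apply: ea; rewrite -!ccompA -sq !ccompA fg.
have [|h [_ hu]] := uni _ (f ∘ c) (f ∘ v); first by rewrite -!ccompA sq.
by rewrite -(hu f) // -(hu g).
Qed.

Lemma epi_strong_iso X Y (f : hom X Y) : epi f -> strong_mono f -> is_iso f.
Proof.
move=> ef [_ sf]; have [|l [lf fl]] := sf _ _ f ef (idm X) (idm Y).
  by rewrite ccompm1 ccomp1m.
by exists l.
Qed.

Lemma split_mono_epi_iso X Y (f : hom X Y) g : g ∘ f = idm X -> epi f -> is_iso f.
Proof.
by move=> gf ef; exists g; split=> //; apply: ef; rewrite -ccompA gf ccomp1m ccompm1.
Qed.

Lemma split_epi_mono_iso X Y (f : hom X Y) g : f ∘ g = idm Y -> mono f -> is_iso f.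
Proof.
by move=> fg mf; exists g; split=> //; apply: mf; rewrite ccompA fg ccomp1m ccompm1.
Qed.

Lemma postcomp_inj X Y (m : hom X Y) : mono m ->
  injective (fun s : {A : C & hom A X} => existT (fun A => hom A Y) _ (m ∘ projT2 s)).
Proof.
move=> mm [A a] [B b] /= e; have AB : A = B := projT1_eq e.
by subst B; rewrite (mm _ _ _ (existT_inj2 e)).
Qed.

Lemma precomp_inj X Y (e : hom X Y) : epi e ->
  injective (fun s : {A : C & hom Y A} => existT (fun A => hom X A) _ (projT2 s ∘ e)).
Proof.
move=> ee [A a] [B b] /= h; have AB : A = B := projT1_eq h.
by subst B; rewrite (ee _ _ _ (existT_inj2 h)).
Qed.

End Categories.

(** * Consequences of the nine axioms *)

Section NineAxioms.
Variables (C : category) (t : terminal_object C) (ax : nine_axioms t).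
Implicit Types W X Y Z A B P Q : C.

Lemma bang_eq X (f g : hom X t) : f = g.
Proof. by rewrite (bang_unique f) (bang_unique g). Qed.

Lemma point_bang (Y : C) (j : hom t Y) : bang t Y ∘ j = idm t.
Proof. exact: bang_eq. Qed.

Lemma point_strong Y (j : hom t Y) : strong_mono j.
Proof.
split=> [P f g _|P Q e ee a b ab]; first exact: bang_eq.
exists (bang t Q); split; first exact: bang_eq.
by apply: ee; rewrite -ab -ccompA; congr (_ ∘ _); apply: bang_eq.
Qed.

(** An isomorphism pulls back along a point [j] to the identity of [t], with other projection
    [g ∘ j], so A9 applies. Thus isomorphic objects are equal, and uniqueness results below are
    equalities. *)
Lemma iso_identity X Y (f : hom X Y) : is_iso f -> is_identity f.
Proof.
move=> isof; apply: (A9 ax); first exact: iso_epi.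
case: isof => g [gf fg] j; exists t, (g ∘ j), (idm t); split; last exact: idm_iso.
split=> [|Q x b xb]; first by rewrite ccompA fg ccomp1m ccompm1.
exists b; split=> [|h [_ <-]]; last by rewrite ccomp1m.
by split; [rewrite -ccompA -xb ccompA gf ccomp1m|rewrite ccomp1m].
Qed.

(** A6 over the identity point of [t] gives an epimorphism [d] to [t] and the pullback [u] of that
    point along [d]. As the pullback of an identity, [u] is an isomorphism. *)
Lemma bang_epi A : epi (bang t A).
Proof.
have [[[D d u su ed [_ uni]] _ _]] := A6 ax A (idm t).
have [|h [[uh _] _]] := uni _ (idm D) d; first by rewrite ccompm1 ccomp1m.
have /iso_epi eu := split_epi_mono_iso uh (proj1 su).
by rewrite -(bang_unique (d ∘ u)); apply: epi_comp.
Qed.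

Lemma epi_of_point B (j : hom t B) : epi j -> t = B :> C.
Proof.
by move=> ej; apply: identity_eq (iso_identity (split_mono_epi_iso (point_bang j) ej)).
Qed.

Lemma ncard_epis_lt X Y (e : hom X Y) : epi e -> ~ is_identity e ->
  ncard (@epis_from C Y) < ncard (@epis_from C X).
Proof.
move=> ee Ne; apply: (ncard_lt (b := existT (hom X) X (idm X)) _ (precomp_inj ee)).
- exact: (A7 ax X).2.
- by move=> [Z g] /= eg; apply: epi_comp.
- exact/iso_epi/idm_iso.
move=> [Z g] /= eg h; apply: Ne; have ZX : Z = X := projT1_eq h.
subst Z; exact/iso_identity/(split_mono_epi_iso (existT_inj2 h)).
Qed.

Lemma ncard_strong_lt X Y (m : hom X Y) : strong_mono m -> ~ is_identity m ->
  ncard (@strong_monos_into C X) < ncard (@strong_monos_into C Y).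
Proof.
move=> sm Nm; apply: (ncard_lt (b := existT (fun A => hom A Y) Y (idm Y)) _
                 (postcomp_inj (proj1 sm))).
- exact: (A7 ax Y).1.
- by move=> [Z g] /= sg; apply: strong_comp.
- exact/iso_strong/idm_iso.
move=> [Z g] /= sg h; apply: Nm; have ZY : Z = Y := projT1_eq h.
subst Z; exact/iso_identity/(split_epi_mono_iso (existT_inj2 h))/(proj1 sm).
Qed.

(** Induction on the number of outgoing epimorphisms: an object that is not normal has a nonidentity
    epimorphism to some [Y] other than [t], and [Y] has fewer. *)
Lemma label_quotient X : X <> t ->
  exists (phi : derived_label t) (d : hom X (proj1_sig phi)), epi d.
Proof.
have [n] := ubnP (ncard (@epis_from C X)); elim: n X => // n IH X le_n Xt.
have [nX|] := pselect (normal_object t X).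
  exists (exist _ X (conj nX Xt)), (idm X); exact/iso_epi/idm_iso.
move=> /existsNP [Y /existsNP [f /not_implyP [[[ef Yt] Nf|[]//]]]].
have [|phi [d ed]] := IH Y _ Yt; first exact: leq_trans (ncard_epis_lt ef Nf) _.
by exists phi, (d ∘ f); apply: epi_comp.
Qed.

(** Collapse [A] to a point by A4. If the quotient [Y] is [t], the pullback square makes [u]
    invertible. Otherwise normality makes [c] an identity, and the same square makes [A] isomorphic
    to [t]. *)
Lemma label_strong_mono X A (u : hom A X) : is_derived_label t X ->
  strong_mono u -> is_identity u \/ A = t.
Proof.
move=> [nX Xt] su.
have [Y [c [v [po sv pb]]]] := A4 ax su (@bang_epi A).
have [Yt|Yt] := pselect (Y = t).
  left; subst Y; have [|h [[uh _] _]] := pb.2 _ (idm X) (bang t X); first exact: bang_eq.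
  exact/iso_identity/(split_epi_mono_iso uh)/(proj1 su).
right; have idc : is_identity c.
  by apply: nX; left; split=> //; apply: pushout_epi po (@bang_epi A).
have XY := identity_eq idc; subst Y; rewrite (identity_idm idc) in pb.
have [|h [[uh _] _]] := pb.2 _ v (idm t); first by rewrite ccomp1m ccompm1.
apply: identity_eq (iso_identity (f := bang t A) _).
exists h; split; last exact: bang_eq.
by apply: (proj1 su); rewrite ccompA uh -pb.1 ccomp1m ccompm1.
Qed.

Lemma label_Comp X : is_derived_label t X ->
  @Comp C X = [set existT (fun A => hom A X) (t : C) j | j in [set: hom t X]].
Proof.
move=> lX; apply/seteqP; split=> [[A u] /= [su Nu _]|_ [j _ <-]].
  have [//|/= At] := label_strong_mono lX su.
  by subst A; exists u.
split=> /=; first exact: point_strong.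
  by move=> /identity_eq tX; apply: lX.2.
move=> B v u su sv _; have [|Bt] := label_strong_mono lX sv; first by right.
by left; subst B; rewrite (bang_eq u (idm t)).
Qed.

Lemma finite_points X : finite_set [set: hom t X].
Proof.
apply: (finite_inj (A7 ax X).1 (f := existT (fun A => hom A X) (t : C))).
  by move=> x y _ _ h; exact: existT_inj2 h.
by move=> j _; apply: point_strong.
Qed.

Lemma label_arityE (phi : derived_label t) :
  ([set: hom t (proj1_sig phi)] #= `I_(label_arity phi))%card.
Proof.
have /finite_setP [n en] := finite_points (proj1_sig phi).
suff -> : label_arity phi = n by [].
apply: ncard_II; rewrite label_Comp; last exact: (proj2_sig phi).
by apply: card_eq_trans en; apply: inj_card_eq => x y _ _ h; exact: existT_inj2 h.
Qed.

Lemma card1_point X : ([set: hom t X] #= `I_1)%card <->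
  exists j : hom t X, forall k : hom t X, k = j.
Proof.
split=> [/eq_cardSP [j _]|[j ju]].
  rewrite II0 card_eq0 => /eqP j1; exists j => k; apply: contrapT => kj.
  by have : ([set: hom t X] `\ j) k by []; rewrite j1.
suff -> : [set: hom t X] = [set j] by apply: card_set1.
by apply/seteqP; split=> // k _; rewrite (ju k).
Qed.

Lemma proper_preimage X B (d : hom X B) (j : hom t B) : epi d -> B <> t ->
  exists K (k : hom K X), [/\ strong_mono k, is_pullback k (bang t K) d j &
    ncard (@strong_monos_into C K) < ncard (@strong_monos_into C X)].
Proof.
move=> ed Bt; have [K [k [q [pb eq]]]] := A3 ax ed (point_strong j).
rewrite (bang_unique q) in pb; exists K, k.
have sk := strong_pullback pb (point_strong j); split=> //.
(* If [k] were an identity, [d] would be [j ∘ bang t X], so [j] would be epi and [B] would be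
   [t]. *)
apply: (ncard_strong_lt sk) => idk; have KX := identity_eq idk; subst K.
apply: Bt; apply: esym; apply: (@epi_of_point _ j); apply: (@epi_of_comp _ X _ _ _ (bang t X)).
by rewrite -pb.1 (identity_idm idk) ccompm1.
Qed.

(* Points of [X] lie in the fibre of a label quotient [X -> phi] over the only
   point of [phi], and this fibre is a smaller object. *)
Lemma arity1_initial :
  (forall phi : derived_label t, label_arity phi = 1) -> is_initial (t : C).
Proof.
move=> ar1 X; have [n] := ubnP (ncard (@strong_monos_into C X)).
elim: n X => // n IH X le_n.
have [->|Xt] := pselect (X = t); first by exists (idm t) => k; apply: bang_eq.
have [phi [d ed]] := label_quotient Xt.
have [j ju] : exists j : hom t (proj1_sig phi), forall k : hom t (proj1_sig phi), k = j.
  by apply/card1_point; rewrite -(ar1 phi); apply: label_arityE.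
have [K [k [sk pb ltK]]] := proper_preimage j ed (proj2_sig phi).2.
have [|i iu] := IH K; first exact: leq_trans ltK _.
exists (k ∘ i) => x; have [|h [[kh _] _]] := pb.2 _ x (idm t).
  by rewrite (ju (d ∘ x)) ccompm1.
by rewrite -kh (iu h).
Qed.

End NineAxioms.

(** * Word categories *)

Lemma suffix_cat (T : Type) (p q u v : seq T) :
  p ++ u = q ++ v -> size u <= size v -> exists r, v = r ++ u.
Proof.
move=> e le_uv; have qp : size q <= size p by have := congr1 size e; rewrite !size_cat; lia.
exists (drop (size q) p).
by rewrite -[LHS](drop_size_cat v (erefl (size q))) -e -{1}(cat_take_drop (size q) p) -catA
           drop_size_cat // size_takel.
Qed.

Lemma prefix_cat (T : Type) (p q u v : seq T) :
  u ++ p = v ++ q -> size u <= size v -> exists r, v = u ++ r.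
Proof.
move=> e le_uv; exists (drop (size u) v).
rewrite -{1}(cat_take_drop (size u) v); congr (_ ++ _).
by rewrite -(takel_cat q le_uv) -e take_size_cat.
Qed.

Lemma suffix_inj (T : Type) (p q u v : seq T) :
  p ++ u = q ++ v -> size u = size v -> u = v.
Proof.
move=> e uv; have [|r er] := suffix_cat e; first by rewrite uv.
have /size0nil r0 : size r = 0 by have := congr1 size er; rewrite size_cat; lia.
by rewrite er r0.
Qed.

Lemma prefix_inj (T : Type) (p q u v : seq T) :
  u ++ p = v ++ q -> size u = size v -> u = v.
Proof.
move=> e uv; have [|r er] := prefix_cat e; first by rewrite uv.
have /size0nil r0 : size r = 0 by have := congr1 size er; rewrite size_cat; lia.
by rewrite er r0 cats0.
Qed.

Lemma is_terminal_object (D : category) (Z : D) :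
  is_terminal Z -> inhabited (terminal_object D).
Proof.
move=> term; pose b X := projT1 (cid (term X)); split.
by exists Z b => X f; rewrite /b; case: cid => g /=; apply.
Qed.

Section WordPresentation.
Variables (C : category) (L : Type) (F : cat_iso C (word_category L)).
Implicit Types W X Y Z A B P Q : C.

(** The axioms are checked in any [C] isomorphic to a word category, so nothing has to be
    transported along [F]. Equations between parallel arrows become arithmetic in [ov]. *)
Definition ov X Y (f : hom X Y) : nat := overlap (fmap F f : word_hom (F X) (F Y)).

Notation len X := (size (F X : seq L)).

Lemma iso_invfunK X : iso_inv F (F X) = X.
Proof. exact: arr_dom (iso_funK F (idm X)). Qed.

Lemma word_inj X Y : F X = F Y -> X = Y.
Proof. by move=> e; rewrite -(iso_invfunK X) e iso_invfunK. Qed.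

Lemma word_surj (u : seq L) : exists X, F X = u.
Proof. exists (iso_inv F u); exact: arr_dom (iso_invK F (idm (u : word_category L))). Qed.

Lemma ov_inj X Y (f g : hom X Y) : ov f = ov g -> f = g.
Proof.
by move=> /word_hom_eq e; apply: arr_inj; rewrite -(iso_funK F f) e iso_funK.
Qed.

Lemma word_full X Y (g : hom (F X) (F Y)) : exists f : hom X Y, fmap F f = g.
Proof.
(* The preimage of [g] has endpoints [iso_inv F (F X)] and [iso_inv F (F Y)]; generalising it allows
   them to be rewritten. *)
have : arr (fmap F (fmap (iso_inv F) g)) = arr g by apply: iso_invK.
move: (fmap (iso_inv F) g); rewrite !iso_invfunK => f /arr_inj <-.
by exists f.
Qed.

Lemma ov_cat X Y (i p s : seq L) : F X = i ++ s :> seq L -> F Y = p ++ i :> seq L ->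
  exists f : hom X Y, ov f = size i.
Proof.
move=> eX eY.
have le : size i <= minn (len X) (len Y) by rewrite eX eY !size_cat; lia.
have eq : pre (size i) (F X) = suf (size i) (F Y).
  by rewrite /pre /suf eX eY take_size_cat // size_cat addnK drop_size_cat.
by have [f e] := @word_full X Y (WordHom le eq); exists f; rewrite /ov e.
Qed.

Lemma ov_split X Y (f : hom X Y) : exists i p s : seq L,
  [/\ F X = i ++ s :> seq L, F Y = p ++ i :> seq L & ov f = size i].
Proof.
rewrite /ov; case: (fmap F f) => r le eq /=.
exists (take r (F X)), (take (len Y - r) (F Y)), (drop r (F X)); split.
- by rewrite cat_take_drop.
- by rewrite [take r _]eq cat_take_drop.
by rewrite size_takel //; lia.
Qed.

Lemma ov_le X Y (f : hom X Y) : ov f <= len X /\ ov f <= len Y.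
Proof. by have := overlap_le (fmap F f : word_hom _ _); rewrite /ov; lia. Qed.

Lemma ov_id X : ov (idm X) = len X.
Proof. by rewrite /ov fmap1. Qed.

Lemma ov_comp X Y Z (g : hom Y Z) (f : hom X Y) :
  ov (g ∘ f) = ov f + ov g - len Y.
Proof. by rewrite /ov fmapM. Qed.

Lemma ov_identity X Y (f : hom X Y) : ov f = len X -> ov f = len Y -> is_identity f.
Proof.
move=> eX eY; have [i [p [s [hX hY e]]]] := ov_split f.
have XY : X = Y.
  apply: word_inj; move: eX eY; rewrite hX hY e !size_cat => h1 h2.
  have /size0nil-> : size s = 0 by lia.
  have /size0nil-> : size p = 0 by lia.
  by rewrite cats0.
subst Y; rewrite (ov_inj (f := f) (g := idm X)) ?ov_id //; exact: IsIdentity.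
Qed.

Lemma identity_ov X Y (f : hom X Y) : is_identity f -> ov f = len X /\ ov f = len Y.
Proof. by case=> Z; rewrite ov_id. Qed.

Lemma factor_suffix Q X P (f : hom Q X) (p : seq L) :
  F X = p ++ F P :> seq L -> ov f <= len P -> exists h : hom Q P, ov h = ov f.
Proof.
move=> eX le; have [i [p' [s [eQ eX' e]]]] := ov_split f; rewrite e in le *.
have [r er] : exists r, (F P : seq L) = r ++ i.
  exact: suffix_cat (etrans (esym eX') eX) le.
exact: ov_cat eQ er.
Qed.

Lemma factor_prefix X Z Y (f : hom X Z) (s : seq L) :
  F X = F Y ++ s :> seq L -> ov f <= len Y -> exists h : hom Y Z, ov h = ov f.
Proof.
move=> eX le; have [i [p [s' [eX' eZ e]]]] := ov_split f; rewrite e in le *.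
have [r er] : exists r, (F Y : seq L) = i ++ r.
  exact: prefix_cat (etrans (esym eX') eX) le.
exact: ov_cat er eZ.
Qed.

Lemma word_epi X Y (f : hom X Y) : epi f <-> ov f = len Y.
Proof.
split=> [ef|e Z g h gh]; last first.
  apply: ov_inj; have := congr1 (@ov _ _) gh; rewrite !ov_comp e.
  by rewrite !addKn.
have [i [p [s [eX eY e]]]] := ov_split f.
case: p eY => [|a p] eY; first by rewrite e eY.
(* The first letter [a] of [Y] lies outside the image [i], so the maps from [Y] to the word [a] with
   overlaps 1 and 0 agree after [f]. *)
have [Z eZ] := word_surj [:: a].
have [g eg] := @ov_cat Y Z [:: a] [::] (p ++ i) eY eZ.
have [h eh] := @ov_cat Y Z [::] [:: a] (F Y) erefl eZ.
suff gh : g = h by rewrite gh eh in eg.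
apply: ef; apply: ov_inj; rewrite !ov_comp eg eh e eY /= size_cat; lia.
Qed.

Lemma word_mono X Y (f : hom X Y) : mono f <-> ov f = len X.
Proof.
split=> [mf|e Z g h gh]; last first.
  apply: ov_inj; have := congr1 (@ov _ _) gh; rewrite !ov_comp e.
  by rewrite !addnK.
have [i [p [s [eX eY e]]]] := ov_split f.
case/lastP: s eX => [|s a] eX; first by rewrite e eX cats0.
have [Z eZ] := word_surj [:: a].
have [|g eg] := @ov_cat Z X [:: a] (i ++ s) [::] eZ; first by rewrite eX -cats1 catA.
have [|h eh] := @ov_cat Z X [::] (F X) [:: a] eZ; first by rewrite cats0.
suff gh : g = h by rewrite gh eh in eg.
apply: mf; apply: ov_inj; rewrite !ov_comp eg eh e eX /= size_cat size_rcons; lia.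
Qed.

Lemma word_strong_mono X Y (f : hom X Y) : strong_mono f <-> ov f = len X.
Proof.
split=> [[/word_mono//]|ef]; split; first exact/word_mono.
move=> P Q e /word_epi ee a b /(congr1 (@ov _ _)); rewrite !ov_comp ef ee => ab.
have [_ le] := ov_le a; have [le' _] := ov_le b.
have [i [p [s [eX eY eif]]]] := ov_split f.
have [||l el] := @factor_suffix Q Y X b p; [|lia|].
  rewrite eY eX; have : size s = 0 by have := congr1 size eX; rewrite size_cat; lia.
  by move/size0nil->; rewrite cats0.
by exists l; split; apply: ov_inj; rewrite ov_comp; lia.
Qed.

Lemma epi_word X Y (f : hom X Y) : epi f -> exists s, F X = F Y ++ s :> seq L.
Proof.
move=> /word_epi ef; have [i [p [s [eX eY e]]]] := ov_split f; exists s.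
have /size0nil p0 : size p = 0 by have := congr1 size eY; rewrite size_cat; lia.
by rewrite eX eY p0.
Qed.

Lemma strong_word X Y (f : hom X Y) : strong_mono f -> exists p, F Y = p ++ F X :> seq L.
Proof.
move=> /word_strong_mono ef; have [i [p [s [eX eY e]]]] := ov_split f; exists p.
have /size0nil s0 : size s = 0 by have := congr1 size eX; rewrite size_cat; lia.
by rewrite eX eY s0 cats0.
Qed.

Lemma word_epi_exists X Y s : F X = F Y ++ s :> seq L ->
  exists2 e : hom X Y, epi e & ov e = len Y.
Proof.
move=> eX; have [e ee] := @ov_cat X Y (F Y) [::] s eX erefl.
by exists e => //; apply/word_epi.
Qed.

Lemma word_strong_exists X Y p : F Y = p ++ F X :> seq L ->
  exists2 m : hom X Y, strong_mono m & ov m = len X.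
Proof.
move=> eY; have [|m em] := @ov_cat X Y (F X) p [::] _ eY; first by rewrite cats0.
by exists m => //; apply/word_strong_mono.
Qed.

(** In words, with [B] for [F B], the arrow [d] is [rBs -> rB] and [q] is [Bs -> B]. Commutation
    bounds the overlap of [x] by the length of [Bs] (pullback) or [rB] (pushout), so [x] factors
    through that suffix or prefix with the same overlap. *)
Lemma word_square P X B Y (p : hom P X) (q : hom P B) (d : hom X Y) (v : hom B Y)
    (s r : seq L) :
    strong_mono p -> epi q -> epi d -> strong_mono v ->
    F X = F Y ++ s :> seq L -> F Y = r ++ F B :> seq L -> F P = F B ++ s :> seq L ->
  is_pullback p q d v /\ is_pushout p q d v.
Proof.
move=> /word_strong_mono ep /word_epi eq /word_epi ed /word_strong_mono ev eX eY eP.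
have eX' : F X = r ++ F P :> seq L by rewrite eX eY eP catA.
have := congr1 size eX; have := congr1 size eY; have := congr1 size eP.
rewrite !size_cat => sP sY sX.
have sq : d ∘ p = v ∘ q by apply: ov_inj; rewrite !ov_comp; lia.
split; split=> // Z x b /(congr1 (@ov _ _)); rewrite !ov_comp => xb.
  have [_ le] := ov_le b; have [h eh] : exists h : hom Z P, ov h = ov x.
    by apply: factor_suffix eX' _; lia.
  exists h; split=> [|h' [hx _]]; first by split; apply: ov_inj; rewrite ov_comp; lia.
  apply: ov_inj; rewrite eh -hx ov_comp; have := ov_le h'; lia.
have [le _] := ov_le b; have [h eh] : exists h : hom Y Z, ov h = ov x.
  by apply: factor_prefix eX _; lia.
exists h; split=> [|h' [hx _]]; first by split; apply: ov_inj; rewrite ov_comp; lia.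
apply: ov_inj; rewrite eh -hx ov_comp; have := ov_le h'; lia.
Qed.

Lemma word_empty_zero Z : F Z = [::] :> seq L -> is_initial Z /\ is_terminal Z.
Proof.
move=> eZ; split=> X.
  have [f _] := @ov_cat Z X [::] (F X) [::] eZ (esym (cats0 _)); exists f => g.
  by apply: ov_inj; have := ov_le g; have := ov_le f; rewrite eZ /=; lia.
have [f _] := @ov_cat X Z [::] [::] (F X) erefl eZ; exists f => g.
by apply: ov_inj; have := ov_le g; have := ov_le f; rewrite eZ /=; lia.
Qed.

Lemma word_pointed : pointed C.
Proof. by have [Z /word_empty_zero] := word_surj [::]; exists Z. Qed.

Lemma word_terminal : inhabited (terminal_object C).
Proof.
have [Z /word_empty_zero [_ term]] := word_surj [::].
exact: is_terminal_object term.
Qed.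

(** A strong subobject is a suffix of the word of [X], hence determined by its length. *)
Lemma strong_mono_ov_inj X : {in @strong_monos_into C X &,
  injective (fun s : {A : C & hom A X} => ov (projT2 s))}.
Proof.
move=> [A a] [B b] /set_mem /= sa /set_mem /= sb e.
have [[p eA] [q eB]] := (strong_word sa, strong_word sb).
have AB : A = B.
  apply/word_inj/(suffix_inj (etrans (esym eA) eB)).
  by rewrite -(iffLR (word_strong_mono a) sa) e; apply/word_strong_mono.
by subst B; rewrite (ov_inj e).
Qed.

Lemma epi_ov_inj X : {in @epis_from C X &,
  injective (fun s : {A : C & hom X A} => ov (projT2 s))}.
Proof.
move=> [A a] [B b] /set_mem /= sa /set_mem /= sb e.
have [[p eA] [q eB]] := (epi_word sa, epi_word sb).
have AB : A = B.
  apply/word_inj/(prefix_inj (etrans (esym eA) eB)).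
  by rewrite -(iffLR (word_epi a) sa) e; apply/word_epi.
by subst B; rewrite (ov_inj e).
Qed.

Lemma word_complexity X : complexity X = len X.
Proof.
(* There is one suffix of each length from 0 to [len X]; [complexity] discards the full one. *)
suff : ncard (@strong_monos_into C X) = (len X).+1.
  by rewrite /complexity => ->; rewrite subn1.
apply: ncard_II; rewrite -(card_eql (inj_card_eq (@strong_mono_ov_inj X))).
suff -> : [set ov (projT2 s) | s in @strong_monos_into C X] = `I_(len X).+1 by [].
apply/seteqP; split=> [_ [[A a] _ <-] /=|r /= le_r].
  by have := ov_le a; lia.
have [A eA] := word_surj (drop (len X - r) (F X)).
have [|a sa ea] := @word_strong_exists A X (take (len X - r) (F X)).
  by rewrite eA cat_take_drop.
by exists (existT _ A a); rewrite //= ea eA size_drop; lia.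
Qed.

Section Terminal.
Variable t : terminal_object C.

Lemma word_one : F t = [::] :> seq L.
Proof.
(* The endomorphism of overlap 0 must be the identity, whose overlap is the length of the word. *)
have [f e] := @ov_cat t t [::] (F t) (F t) erefl (esym (cats0 _)).
by apply: size0nil; rewrite -ov_id (bang_unique (idm t)) -(bang_unique f).
Qed.

(** The terminal object is the concatenation of [B] and [A]; every object of the category turns out
    to have this underlying word. *)
Lemma word_A6 A B (j : hom t B) : inhabited (terminal_object (ins_category A j)).
Proof.
have [D eD] := word_surj (F B ++ F A).
have [u su eu] := word_strong_exists eD; have [d ed ed0] := word_epi_exists eD.
have pb : is_pullback u (bang t A) d j.
  apply: (word_square su _ ed _ eD (r := F B) _ _).1; rewrite ?word_one ?cats0 //.
    by apply/word_epi; have := ov_le (bang t A); rewrite word_one /=; lia.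
  by apply/word_strong_mono; have := ov_le j; rewrite word_one /=; lia.
pose T : ins_category A j := InsObj su ed pb.
apply: (@is_terminal_object _ (T : ins_category A j)) => -[D' d' u' su' ed' pb'].
have [s' eD'] := epi_word ed'; have [r' eD''] := strong_word su'.
move/word_strong_mono: (su') => eu'; move/word_epi: (ed') => edd'.
(* The suffix [s'] deleted by [d'] factors through the fibre [u'], so it is no longer than [A]; the
   commuting square gives the converse inequality. *)
have [K eK] := word_surj s'.
have [|k sk ek] := @word_strong_exists K D' (F B); first by rewrite eD' eK.
have [|h [[uh _] _]] := pb'.2 _ k (bang t K).
  apply: ov_inj; rewrite !ov_comp ek edd' eD' eK word_one !size_cat.
  by have := ov_le (bang t K); have := ov_le j; rewrite word_one /=; lia.
have szA : len A = size s'.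
  have := congr1 (@ov _ _) pb'.1; have := congr1 (@ov _ _) uh.
  rewrite !ov_comp ek eK eu' edd' eD' size_cat word_one.
  by have := ov_le h; have := ov_le j; have := ov_le (bang t A); rewrite eK word_one /=; lia.
have D'D : D' = D.
  apply: word_inj; rewrite eD eD'; congr (_ ++ _).
  by apply: suffix_inj (etrans (esym eD') eD'') _.
subst D'.
have hu : idm D ∘ u' = u by apply: ov_inj; rewrite ov_comp ov_id; lia.
have hd : d ∘ idm D = d' by apply: ov_inj; rewrite ov_comp ov_id; lia.
exists (InsHom (S := InsObj su' ed' pb') (T := T) hu hd) => -[h' hu' hd'].
apply: ins_hom_eq; apply: ov_inj; rewrite /= ov_id.
have := congr1 (@ov _ _) hu'; have := congr1 (@ov _ _) hd'.
rewrite /= !ov_comp; have := ov_le h'; have := congr1 size eD; rewrite size_cat; lia.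
Qed.

Lemma word_nine_axioms : nine_axioms t.
Proof.
split.
- move=> X Y f; have [i [p [s [eX eY e]]]] := ov_split f; have [I eI] := word_surj i.
  rewrite -eI in eX eY; have [g eg eg'] := word_epi_exists eX.
  have [m sm em] := word_strong_exists eY; exists I, g, m; split=> //.
  by apply: ov_inj; rewrite ov_comp e eg' em eI addnK.
- move=> X Y B d v ed sv; have [s eX] := epi_word ed; have [r eY] := strong_word sv.
  have [P eP] := word_surj (F B ++ s); have [q eq _] := word_epi_exists eP.
  have [|p sp _] := @word_strong_exists P X r; first by rewrite eX eY eP catA.
  by exists P, p, q; split=> //; apply: (word_square sp eq ed sv eX eY eP).1.
- move=> A X B u a su ea; have [s eA] := epi_word ea; have [r eX] := strong_word su.
  have [Y eY] := word_surj (r ++ F B); have [v sv _] := word_strong_exists eY.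
  have eX' : F X = F Y ++ s :> seq L by rewrite eX eA eY catA.
  have [c ec _] := word_epi_exists eX'; exists Y, c, v.
  by have [pb po] := word_square su ea ec sv eX' eY eA.
(* Since [t] is initial, [Y] has a single point, and A5 reduces to [c] being epi. *)
- move=> A X B Y u a c v _ [ea _] po; split; first exact: pushout_epi po ea.
  move=> j k _ _; have [f fu] := (word_empty_zero word_one).1 Y.
  by rewrite (fu j) (fu k).
- exact: word_A6.
- move=> X; split.
    apply: (finite_inj (finite_II (len X).+1) (@strong_mono_ov_inj X)).
    by move=> [A a] _ /=; have := ov_le a; lia.
  apply: (finite_inj (finite_II (len X).+1) (@epi_ov_inj X)).
  by move=> [A a] _ /=; have := ov_le a; lia.
- move=> W X Y Z a b c d /word_strong_mono ea /word_strong_mono eb sc sd cadb.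
  have [[p eZ] [q eZ']] := (strong_word sc, strong_word sd).
  move/word_strong_mono: sc => ec; move/word_strong_mono: sd => ed.
  have [le|/ltnW le] := leqP (len X) (len Y); [left|right].
    have [|h eh] := @factor_suffix X Z Y c q eZ'; first by rewrite ec.
    by exists h; split; apply: ov_inj; rewrite !ov_comp; lia.
  have [|h eh] := @factor_suffix Y Z X d p eZ; first by rewrite ed.
  by exists h; split; apply: ov_inj; rewrite !ov_comp; lia.
- move=> X Y d ed iso_d; have [s eX] := epi_word ed; have [K eK] := word_surj s.
  have [j _] := (word_empty_zero word_one).1 Y.
  have [P [p [q [pb [g [gq _]]]]]] := iso_d j.
  (* The suffix [s] deleted by [d] factors through the fibre [P], which is isomorphic to [t], so [s]
     is empty. *)
  have [|k sk ek] := @word_strong_exists K X (F Y); first by rewrite eX eK.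
  move/word_epi: (ed) => ed'.
  have [|h [[ph _] _]] := pb.2 _ k (bang t K).
    apply: ov_inj; rewrite !ov_comp ek ed' eX eK word_one !size_cat.
    by have := ov_le (bang t K); have := ov_le j; rewrite word_one eK /=; lia.
  have P0 : len P = 0.
    by rewrite -ov_id -gq ov_comp; have := ov_le q; have := ov_le g; rewrite word_one /=; lia.
  have s0 : size s = 0.
    by rewrite -eK -ek -ph ov_comp; have := ov_le h; have := ov_le p; lia.
  by apply: ov_identity; rewrite ed' // eX size_cat s0; lia.
Qed.

Lemma word_label X : is_derived_label t X <-> len X = 1.
Proof.
split=> [[nX Xt]|X1].
  case eX: (F X : seq L) => [|a s]; first by case: Xt; apply: word_inj; rewrite eX word_one.
  (* The first letter is a quotient of [X] other than [t], so normality forces [X] to be that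
     letter. *)
  have [Y eY] := word_surj [:: a].
  have [|e ee _] := @word_epi_exists X Y s; first by rewrite eX eY.
  have /nX/identity_ov [] : Ecirc t e.
    by left; split=> // Yt; move: eY; rewrite Yt word_one.
  by move=> ->; rewrite eX eY.
split=> [Y f|Xt]; last by move: X1; rewrite Xt word_one.
case=> [[ef Yt]|[]//]; have [s eX] := epi_word ef; move/word_epi: ef => ef.
have Y0 : len Y != 0.
  by apply/eqP => /size0nil Y0; apply: Yt; apply: word_inj; rewrite Y0 word_one.
by apply: ov_identity; rewrite ef //; move: X1; rewrite eX size_cat; lia.
Qed.

Lemma word_letters : exists2 g : L -> derived_label t, bijective g &
  forall l : L, F (proj1_sig (g l)) = [:: l].
Proof.
have label_of l : exists phi : derived_label t, F (proj1_sig phi) = [:: l].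
  have [X eX] := word_surj [:: l].
  have lX : is_derived_label t X by apply/word_label; rewrite eX.
  by exists (exist _ X lX).
have [g gE] := choice label_of.
have letter_of (phi : derived_label t) : exists l, F (proj1_sig phi) = [:: l].
  have /word_label := proj2_sig phi; case: (F _ : seq L) => [|l [|]] // _.
  by exists l.
have [h hE] := choice letter_of.
exists g => //; exists h => [l|phi].
  by have := hE (g l); rewrite gE => -[].
by apply: eq_sig_hprop => [*|]; [apply: Prop_irrelevance|apply: word_inj; rewrite gE hE].
Qed.

End Terminal.
End WordPresentation.

(** * Pointed categories *)

Lemma cat_iso_of_words (C : category) (L : Type) (w : C -> seq L)
    (ov : forall X Y : C, hom X Y -> nat) :
    (forall X Y, w X = w Y -> X = Y) -> (forall u, exists X, w X = u) ->
    (forall X Y (f g : hom X Y), ov _ _ f = ov _ _ g -> f = g) ->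
    (forall X Y (f : hom X Y), ov _ _ f <= minn (size (w X)) (size (w Y)) /\
      pre (ov _ _ f) (w X) = suf (ov _ _ f) (w Y)) ->
    (forall X Y r, r <= minn (size (w X)) (size (w Y)) -> pre r (w X) = suf r (w Y) ->
      exists f : hom X Y, ov _ _ f = r) ->
    (forall X, ov _ _ (idm X) = size (w X)) ->
    (forall X Y Z (g : hom Y Z) (f : hom X Y),
      ov _ _ (g ∘ f) = ov _ _ f + ov _ _ g - size (w Y)) ->
  exists F : cat_iso C (word_category L), forall X, F X = w X.
Proof.
move=> w_inj /choice [v vK] ov_inj ov_ok ov_surj ov_id ov_comp.
pose W := word_category L.
pose Fm X Y (f : hom X Y) : hom (w X : W) (w Y : W) :=
  WordHom (ov_ok X Y f).1 (ov_ok X Y f).2.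
have F1 X : Fm _ _ (idm X) = idm (w X : W) by apply: word_hom_eq; rewrite /= ov_id.
have FM X Y Z (g : hom Y Z) (f : hom X Y) : Fm _ _ (g ∘ f) = Fm _ _ g ∘ Fm _ _ f.
  by apply: word_hom_eq; rewrite /= ov_comp.
pose F := Functor F1 FM.
have G_ex (x y : W) (r : hom x y) : exists f : hom (v x) (v y), ov _ _ f = overlap r.
  by apply: ov_surj; rewrite !vK; [exact: overlap_le|exact: overlap_eq].
pose Gm (x y : W) (r : hom x y) : hom (v x) (v y) := projT1 (cid (G_ex x y r)).
have GmE x y r : ov _ _ (Gm x y r) = overlap r by rewrite /Gm; case: cid.
have G1 x : Gm x x (idm x) = idm (v x) by apply: ov_inj; rewrite GmE ov_id vK.
have GM x y z (g : hom y z) (f : hom x y) : Gm _ _ (g ∘ f) = Gm _ _ g ∘ Gm _ _ f.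
  by apply: ov_inj; rewrite ov_comp !GmE vK.
pose G := Functor G1 GM.
have FK X Y (f : hom X Y) : arr (fmap G (fmap F f)) = arr f.
  have : ov _ _ (fmap G (fmap F f)) = ov _ _ f by rewrite GmE.
  move: (fmap G _) => /=; have vw Z : v (w Z) = Z by apply: w_inj; rewrite vK.
  by rewrite !vw => f' /ov_inj ->.
have GK (x y : W) (r : hom x y) : arr (fmap F (fmap G r)) = arr r.
  have : overlap (fmap F (fmap G r) : word_hom _ _) = overlap r by rewrite /= GmE.
  by move: (fmap F _) => /=; rewrite !vK => r' /word_hom_eq ->.
by exists (@CatIso C W F G FK GK).
Qed.

Section Pointed.
Variables (C : category) (t : terminal_object C) (ax : nine_axioms t).
Hypothesis t_init : is_initial (t : C).
Implicit Types W X Y Z A B P Q : C.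

(** * Zero maps and short exact sequences *)

Definition zero_point Y : hom t Y := projT1 (cid (t_init Y)).

Lemma from_zero_eq Y (f g : hom t Y) : f = g.
Proof. by have [h hu] := t_init Y; rewrite (hu f) (hu g). Qed.

Definition zero_map X Y : hom X Y := zero_point Y ∘ bang t X.

Lemma zero_map_through X Y (f : hom t Y) (g : hom X t) : f ∘ g = zero_map X Y.
Proof. by rewrite (from_zero_eq f (zero_point Y)) (bang_unique g). Qed.

Lemma comp_zero_map X Y Z (g : hom Y Z) : g ∘ zero_map X Y = zero_map X Z.
Proof. by rewrite /zero_map ccompA zero_map_through. Qed.

Lemma comp_zero_map_l X Y Z (f : hom X Y) : zero_map Y Z ∘ f = zero_map X Z.
Proof. by rewrite /zero_map -ccompA zero_map_through. Qed.

Lemma epi_zero_map A B : epi (zero_map A B) -> t = B :> C.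
Proof. by move=> /epi_of_comp; apply: epi_of_point. Qed.

(** A short exact sequence. The kernel condition is the pullback of A6, so extensions of [B] by [A]
    are exactly the objects of [ins_category A (zero_point B)]. *)
Definition extension A X B (u : hom A X) (d : hom X B) : Prop :=
  [/\ strong_mono u, epi d & is_pullback u (bang t A) d (zero_point B)].

Lemma extensionI A X B (u : hom A X) (d : hom X B) :
    strong_mono u -> epi d -> d ∘ u = zero_map A B ->
    (forall Q (x : hom Q X), d ∘ x = zero_map Q B -> exists h, u ∘ h = x) ->
  extension u d.
Proof.
move=> su ed du lift; split=> //; split=> // Q x b dx.
have [|h uh] := lift Q x; first by rewrite dx zero_map_through.
exists h; split=> [|h' [uh' _]]; first by split=> //; apply: bang_eq.
by apply: (proj1 su); rewrite uh.
Qed.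

Lemma extension_zero A X B (u : hom A X) (d : hom X B) :
  extension u d -> d ∘ u = zero_map A B.
Proof. by case=> _ _ [-> _]. Qed.

Lemma extension_lift A X B (u : hom A X) (d : hom X B) : extension u d ->
  forall Q (x : hom Q X), d ∘ x = zero_map Q B -> exists h, u ∘ h = x.
Proof. by case=> _ _ [_ uni] Q x /uni [h [[uh _] _]]; exists h. Qed.

Lemma kernel_exists X B (d : hom X B) : epi d -> exists A (u : hom A X), extension u d.
Proof.
move=> ed; have [K [k [q [pb _]]]] := A3 ax ed (point_strong (zero_point B)).
exists K, k; split=> //; first exact: strong_pullback pb (point_strong _).
by rewrite -(bang_unique q).
Qed.

(** The cokernel is the pushout of [bang t A] along [u]; since the square of A4 is also a pullback,
    [u] is the kernel of its cokernel. *)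
Lemma cokernel_exists A X (u : hom A X) : strong_mono u ->
  exists B (d : hom X B), extension u d /\
    forall Z (x : hom X Z), x ∘ u = zero_map A Z -> exists h, h ∘ d = x.
Proof.
move=> su; have [Y [c [v [po sv pb]]]] := A4 ax su (bang_epi ax (A:=A)).
exists Y, c; split=> [|Z x xu].
  by split=> //; [exact: pushout_epi po (bang_epi ax (A:=A))|
                rewrite (from_zero_eq (zero_point Y) v)].
by have [h [[hc _] _]] := po.2 _ x (zero_point Z) xu; exists h.
Qed.

(** The only point of [Y] is zero, and the fibre of [d] over it is the kernel. When this is [t], A9
    applies. *)
Lemma trivial_kernel X Y (d : hom X Y) : epi d ->
  (forall Q (x : hom Q X), d ∘ x = zero_map Q Y -> x = zero_map Q X) -> is_identity d.
Proof.
move=> ed triv; apply: (A9 ax ed) => j; exists (t : C), (zero_point X), (idm t).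
split; last exact: idm_iso; split=> [|Q x b dx]; first exact: from_zero_eq.
exists (bang t Q); split=> [|h _]; last exact: bang_eq.
split; last exact: bang_eq.
by rewrite [RHS]triv // dx zero_map_through.
Qed.

(** Compare [d] with the cokernel [c] of [u] by an epimorphism [h]. The kernel [k] of [h], pulled
    back along [c], gives a [p] killed by [d], which lifts through [u] and so is killed by [c].
    Hence the epimorphism [q] onto [K] is zero, [K] is [t], and [h] is an identity. *)
Lemma extension_cokernel A X B (u : hom A X) (d : hom X B) : extension u d ->
  forall Z (x : hom X Z), x ∘ u = zero_map A Z -> exists h, h ∘ d = x.
Proof.
move=> e; have [su ed _] := e; have [Y [c [ec c_uni]]] := cokernel_exists su.
have [h hc] := c_uni _ d (extension_zero e).
have eh : epi h by apply: (@epi_of_comp _ X _ _ _ c); rewrite hc.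
suff idh : is_identity h.
  have YB := identity_eq idh; subst Y; move: hc.
  by rewrite (identity_idm idh) ccomp1m => <-.
have [K [k ek]] := kernel_exists eh; have [sk _ _] := ek.
have [P [p [q [[sq _] eq]]]] := A3 ax (let: And3 _ ec _ := ec in ec) sk.
have [|l ul] := extension_lift e (x := p).
  by rewrite -hc -ccompA sq ccompA (extension_zero ek) comp_zero_map_l.
have q0 : q = zero_map P K.
  by apply: (proj1 sk); rewrite comp_zero_map -sq -ul ccompA
                               (extension_zero ec) comp_zero_map_l.
rewrite q0 in eq; have Kt := epi_zero_map eq; subst K.
apply: trivial_kernel eh _ => Q x /(extension_lift ek) [y <-].
by rewrite zero_map_through.
Qed.

(** The short five lemma. The kernel of [h] is trivial, so its epi part is an identity and [h] is a
    strong monomorphism. Its cokernel factors through [d'] as [z] with [z ∘ d] zero, so it vanishes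
    as well. *)
Lemma extension_morphism_identity A X X' B (u : hom A X) (d : hom X B)
    (u' : hom A X') (d' : hom X' B) (h : hom X X') :
  extension u d -> extension u' d' -> h ∘ u = u' -> d' ∘ h = d -> is_identity h.
Proof.
move=> e e' hu dh; have [su ed _] := e; have [su' ed' _] := e'.
have h0 Q (x : hom Q X) : h ∘ x = zero_map Q X' -> x = zero_map Q X.
  move=> hx; have [|y uy] := extension_lift e (x := x).
    by rewrite -dh -ccompA hx comp_zero_map.
  have y0 : y = zero_map Q A by apply: (proj1 su'); rewrite -hu -ccompA uy hx comp_zero_map.
  by rewrite -uy y0 comp_zero_map.
have [I [p [m [ep sm hE]]]] := A2 ax h.
have idp : is_identity p.
  by apply: trivial_kernel ep _ => Q x px; apply: h0; rewrite hE -ccompA px comp_zero_map.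
have XI := identity_eq idp; subst I; rewrite (identity_idm idp) ccompm1 in hE.
subst m; apply: (iso_identity ax).
have [Z [c [ec _]]] := cokernel_exists sm; have [_ epic _] := ec.
have [|z zd] := extension_cokernel e' (x := c).
  by rewrite -hu ccompA (extension_zero ec) comp_zero_map_l.
have z0 : z = zero_map B Z.
  by apply: ed; rewrite comp_zero_map_l -dh ccompA zd (extension_zero ec).
have [|k hk] := extension_lift ec (x := idm X').
  by rewrite ccompm1 -zd z0 comp_zero_map_l.
exact: split_epi_mono_iso hk (proj1 sm).
Qed.

Lemma extension_unique A X X' B (u : hom A X) (d : hom X B) (u' : hom A X') (d' : hom X' B) :
  extension u d -> extension u' d' -> arr u = arr u' /\ arr d = arr d'.
Proof.
have [[T b _]] := A6 ax A (zero_point B).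
suff to_T Y (w : hom A Y) (c : hom Y B) :
    extension w c -> arr w = arr (ins_u T) /\ arr c = arr (ins_d T).
  by move=> /to_T [-> ->] /to_T [-> ->].
move=> e; have [sw ec pb] := e; have [h hw ch] := b (InsObj sw ec pb).
have eT : extension (ins_u T) (ins_d T).
  by split; [exact: ins_u_strong|exact: ins_d_epi|exact: ins_pullback].
have idh := extension_morphism_identity e eT hw ch.
by rewrite -(arr_identity_compl _ idh) hw -(arr_identity_compr _ idh) ch.
Qed.

Lemma extension_exists A B : exists X (u : hom A X) (d : hom X B), extension u d.
Proof.
have [[[X d u su ed pb] _ _]] := A6 ax A (zero_point B).
by exists X, u, d.
Qed.

Lemma extension_zero_l X : extension (zero_point X) (idm X).
Proof.
apply: extensionI; first exact: point_strong.
- exact/iso_epi/idm_iso.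
- by rewrite ccomp1m /zero_map (bang_eq (bang t t) (idm t)) ccompm1.
by move=> Q x; rewrite ccomp1m => ->; exists (bang t Q).
Qed.

(* The third isomorphism theorem; it makes [spelling] multiplicative. *)
Lemma extension_assoc A X B B' D (u : hom A X) (d : hom X B) (u' : hom B' B)
    (d' : hom B D) : extension u d -> extension u' d' ->
  exists X' (p : hom X' X) (v : hom A X') (q : hom X' B'),
    extension p (d' ∘ d) /\ extension v q.
Proof.
move=> e e'; have [su ed _] := e; have [su' ed' _] := e'.
have [P [p [q [pb eq]]]] := A3 ax ed su'; have sp := strong_pullback pb su'.
have [|v [[pv qv] _]] := pb.2 _ u (zero_map A B').
  by rewrite (extension_zero e) comp_zero_map.
exists P, p, v, q; split; apply: extensionI => //.
- exact: epi_comp.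
- by rewrite -ccompA pb.1 ccompA (extension_zero e') comp_zero_map_l.
- move=> Q x; rewrite -ccompA => /(extension_lift e') [b ub].
  by have [h [[ph _] _]] := pb.2 _ x b (esym ub); exists h.
- by apply: strong_of_comp sp; rewrite pv.
move=> Q x qx; have [|h uh] := extension_lift e (x := p ∘ x).
  by rewrite ccompA pb.1 -ccompA qx comp_zero_map.
by exists h; apply: (proj1 sp); rewrite ccompA pv.
Qed.

(** * Composition series read as words of labels *)

Fixpoint spells (s : seq (derived_label t)) (X : C) : Prop :=
  if s is phi :: s' then
    exists A (u : hom A X) (d : hom X (proj1_sig phi)), extension u d /\ spells s' A
  else X = t.

Lemma spells_exists X : exists s, spells s X.
Proof.
have [n] := ubnP (ncard (@strong_monos_into C X)); elim: n X => // n IH X le_n.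
have [->|Xt] := pselect (X = t); first by exists [::].
have [phi [d ed]] := label_quotient ax Xt.
have [K [k [sk pb ltK]]] := proper_preimage ax (zero_point _) ed (proj2_sig phi).2.
have [|s sK] := IH K; first exact: leq_trans ltK _.
by exists (phi :: s), K, k, d.
Qed.

Lemma spells_surj s : exists X, spells s X.
Proof.
elim: s => [|phi s [A sA]]; first by exists (t : C).
by have [X [u [d e]]] := extension_exists A (proj1_sig phi); exists X, A, u, d.
Qed.

Lemma spells_inj s X Y : spells s X -> spells s Y -> X = Y.
Proof.
elim: s X Y => [|phi s IH] X Y /=; first by move=> -> ->.
move=> [A [u [d [e sA]]]] [A' [u' [d' [e' sA']]]].
have AA' := IH _ _ sA sA'; subst A'.
exact: arr_cod (extension_unique e e').1.
Qed.

(** The Jordan-Hölder step. By A8 the two kernels are comparable, as both contain the zero point. If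
    [K] lies in [K'], then [d'] factors through [d] by an epimorphism out of the normal object
    [phi], which is an identity. *)
Lemma label_quotient_unique X (phi psi : derived_label t) K K'
    (u : hom K X) (d : hom X (proj1_sig phi))
    (u' : hom K' X) (d' : hom X (proj1_sig psi)) :
  extension u d -> extension u' d' -> phi = psi /\ K = K'.
Proof.
wlog [h uh] : phi psi K K' u d u' d' / exists h : hom K K', u' ∘ h = u.
  move=> wl e e'; have [[su _ _] [su' _ _]] := (e, e').
  have [|[h [_ uh]]|[h [_ uh]]] :=
    A8 ax (point_strong (zero_point K)) (point_strong (zero_point K')) su su'.
  - exact: from_zero_eq.
  - by apply: wl e e'; exists h.
  by have [|-> ->] := wl _ _ _ _ _ _ _ _ _ e' e; first by exists h.
move=> e e'; have [z zd] : exists z, z ∘ d = d'.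
  by apply: (extension_cokernel e); rewrite -uh ccompA (extension_zero e') comp_zero_map_l.
have [[su ed _] [su' ed' _]] := (e, e').
have idz : is_identity z.
  apply: (proj2_sig phi).1; left; split; last exact: (proj2_sig psi).2.
  by apply: (@epi_of_comp _ _ _ _ _ d); rewrite zd.
have phipsi : phi = psi.
  by apply: eq_sig_hprop (identity_eq idz) => *; apply: Prop_irrelevance.
split=> //; subst psi; rewrite (identity_idm idz) ccomp1m in zd; subst d'.
have [k uk] := extension_lift e (extension_zero e').
apply: identity_eq (iso_identity ax (f := h) _); exists k.
split; [apply: (proj1 su)|apply: (proj1 su')].
  by rewrite ccompA uk uh ccompm1.
by rewrite ccompA uh uk ccompm1.
Qed.

Lemma no_label_quotient_t (phi : derived_label t) (d : hom t (proj1_sig phi)) : ~ epi d.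
Proof. by move=> /(epi_of_point ax) /esym; apply: (proj2_sig phi).2. Qed.

Lemma spells_unique s s' X : spells s X -> spells s' X -> s = s'.
Proof.
elim: s s' X => [|phi s IH] [|psi s'] X //=.
- move=> -> [A [u [d [[_ ed _] _]]]]; by case: (no_label_quotient_t ed).
- move=> [A [u [d [[_ ed _] _]]]] Xt; subst X; by case: (no_label_quotient_t ed).
move=> [A [u [d [e sA]]]] [A' [u' [d' [e' sA']]]].
have [-> AA'] := label_quotient_unique e e'; subst A'.
by rewrite (IH _ _ sA sA').
Qed.

(** Induction on [b]. The first letter of [B] is also a quotient of [X], and by [extension_assoc]
    its kernel there is an extension of [B'] by [A]. For empty [b], [B] is [t] and [u] is an
    isomorphism. *)
Lemma spells_extension A X B (u : hom A X) (d : hom X B) a b : extension u d ->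
  spells a A -> spells b B -> spells (b ++ a) X.
Proof.
elim: b A X B u d => [|phi b IH] A X B u d e sA /=.
  move=> Bt; subst B; have [|h uh] := extension_lift e (x := idm X).
    by rewrite ccompm1; apply: bang_eq.
  have [[mu _] _ _] := e.
  by have <- := identity_eq (iso_identity ax (split_epi_mono_iso uh mu)).
move=> [B' [u' [d' [e' sB']]]].
have [X' [p [v [q [ep ev]]]]] := extension_assoc e e'.
by exists X', p, (d' ∘ d); split=> //; apply: IH ev sA sB'.
Qed.

Definition spelling X : seq (derived_label t) := projT1 (cid (spells_exists X)).

Lemma spellingP X : spells (spelling X) X.
Proof. by rewrite /spelling; case: cid. Qed.

Lemma spelling_extension A X B (u : hom A X) (d : hom X B) :
  extension u d -> spelling X = spelling B ++ spelling A.
Proof.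
move=> e; apply: spells_unique (spellingP X) _.
exact: spells_extension e (spellingP A) (spellingP B).
Qed.

Lemma spelling_inj X Y : spelling X = spelling Y -> X = Y.
Proof. by move=> e; have := spellingP Y; rewrite -e; apply: spells_inj (spellingP X). Qed.

Lemma spelling_surj s : exists X, spelling X = s.
Proof.
by have [X sX] := spells_surj s; exists X; apply: spells_unique (spellingP X) sX.
Qed.

Lemma spelling_one : spelling t = [::].
Proof. exact: (spells_unique (spellingP t) (s' := [::])). Qed.

Lemma spelling_label (phi : derived_label t) : spelling (proj1_sig phi) = [:: phi].
Proof.
apply: spells_unique (spellingP _) _; exists (t : C), (zero_point _), (idm _).
by split=> //; exact: extension_zero_l.
Qed.

Lemma spelling_epi X I (e : hom X I) : epi e -> exists s, spelling X = spelling I ++ s.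
Proof. by move=> /kernel_exists [A [u /spelling_extension ->]]; exists (spelling A). Qed.

Lemma spelling_strong I Y (m : hom I Y) :
  strong_mono m -> exists p, spelling Y = p ++ spelling I.
Proof. by move=> /cokernel_exists [B [d [/spelling_extension -> _]]]; exists (spelling B). Qed.

Lemma spelling_extension_exists X p s : spelling X = p ++ s ->
  exists A B (u : hom A X) (d : hom X B), [/\ extension u d, spelling A = s & spelling B = p].
Proof.
move=> eX; have [[A eA] [B eB]] := (spelling_surj s, spelling_surj p).
have [X' [u [d e]]] := extension_exists A B.
have X'X : X' = X by apply: spelling_inj; rewrite (spelling_extension e) eA eB eX.
by subst X'; exists A, B, u, d.
Qed.

(** Cancelling the prefix [spelling I] shows that the kernels are the same object, so
    [extension_unique] applies. *)
Lemma spelling_epi_unique X I (e e' : hom X I) : epi e -> epi e' -> e = e'.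
Proof.
move=> /kernel_exists [A [u ue]] /kernel_exists [A' [u' ue']].
have AA' : A = A'.
  apply: spelling_inj; have := spelling_extension ue'; rewrite (spelling_extension ue) => h.
  by have := congr1 (drop (size (spelling I))) h; rewrite !drop_size_cat.
by subst A'; apply: arr_inj (extension_unique ue ue').2.
Qed.

Lemma spelling_strong_unique I Y (m m' : hom I Y) : strong_mono m -> strong_mono m' -> m = m'.
Proof.
move=> /cokernel_exists [B [d [md _]]] /cokernel_exists [B' [d' [md' _]]].
have BB' : B = B'.
  apply: spelling_inj; have e := spelling_extension md'; rewrite (spelling_extension md) in e.
  by apply: (prefix_inj e); have := congr1 size e; rewrite !size_cat; lia.
by subst B'; apply: arr_inj (extension_unique md md').1.
Qed.

(** * Length of the image and the isomorphism with words *)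

Definition im_len X Y (f : hom X Y) : nat := size (spelling (projT1 (cid (A2 ax f)))).

(** Removes the choice made in [im_len]: two factorisations are linked by a map that is epi and
    strong mono, hence an identity. *)
Lemma im_lenE X Y I (e : hom X I) (m : hom I Y) : epi e -> strong_mono m ->
  im_len (m ∘ e) = size (spelling I).
Proof.
move=> ee sm; rewrite /im_len; case: cid => I' /= [e' [m' [ee' sm' eq]]].
have [l [le ml]] := (proj2 sm') _ _ e ee e' m (esym eq).
have el : epi l by apply: (@epi_of_comp _ _ _ _ _ e); rewrite le.
have sl : strong_mono l by apply: strong_of_comp sm'; rewrite ml.
by rewrite (identity_eq (iso_identity ax (epi_strong_iso el sl))).
Qed.

(* The image of [g ∘ f] is the quotient of the image [I] of [f] by its
   intersection with the kernel [N] of [g], and by A8 that intersection is the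
   smaller of [I] and [N]. *)
Lemma im_len_comp X Y Z (g : hom Y Z) (f : hom X Y) :
  im_len (g ∘ f) = im_len f + im_len g - size (spelling Y).
Proof.
have [I [e [m [ee sm ->]]]] := A2 ax f; have [J [e' [m' [ee' sm' ->]]]] := A2 ax g.
have [K [e'' [m'' [ee'' sm'' eK]]]] := A2 ax (e' ∘ m).
have -> : m' ∘ e' ∘ (m ∘ e) = (m' ∘ m'') ∘ (e'' ∘ e).
  by rewrite -ccompA [e' ∘ _]ccompA eK !ccompA.
rewrite !im_lenE //; [|exact: epi_comp|exact: strong_comp].
have [N [n en]] := kernel_exists ee'; have [sn _ _] := en.
rewrite (spelling_extension en) size_cat.
have [|[h [_ nh]]|[k [_ mk]]] :=
    A8 ax (point_strong (zero_point I)) (point_strong (zero_point N)) sm sn.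
- exact: from_zero_eq.
(* Here [I] lies in [N]: the composite is zero and the truncated difference is 0. *)
- have sh : strong_mono h by apply: strong_of_comp sn; rewrite nh.
  have [p eN] := spelling_strong sh.
  have /epi_zero_map Kt : epi (zero_map I K).
    suff <- : e'' = zero_map I K by [].
    apply: (proj1 sm''); rewrite -eK -nh ccompA (extension_zero en) comp_zero_map_l.
    by rewrite comp_zero_map.
  by rewrite -Kt spelling_one eN size_cat /=; lia.
(* Here [N] lies in [I], and [K] is the quotient of [I] by [N]. *)
have sk : strong_mono k by apply: strong_of_comp sm; rewrite mk.
have ek : extension k e''.
  apply: extensionI => //.
    by apply: (proj1 sm''); rewrite ccompA -eK -ccompA mk (extension_zero en) comp_zero_map.
  move=> Q x ex; have [|y ny] := extension_lift en (x := m ∘ x).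
    by rewrite ccompA eK -ccompA ex comp_zero_map.
  by exists y; apply: (proj1 sm); rewrite ccompA mk.
by rewrite (spelling_extension ek) size_cat; lia.
Qed.

Lemma pointed_cat_iso :
  exists F : cat_iso C (word_category (derived_label t)),
    forall phi : derived_label t, F (proj1_sig phi) = [:: phi].
Proof.
suff [F FE] : exists F : cat_iso C (word_category (derived_label t)),
    forall X, F X = spelling X.
  by exists F => phi; rewrite FE spelling_label.
apply: (cat_iso_of_words (ov := im_len)).
- exact: spelling_inj.
- exact: spelling_surj.
(* Images of equal length are equal prefixes of [spelling X], hence the same object, and both
   factors are then unique. *)
- move=> X Y f g; have [I [e [m [ee sm ->]]]] := A2 ax f.
  have [I' [e' [m' [ee' sm' ->]]]] := A2 ax g; rewrite !im_lenE // => eI.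
  have [[s eX] [s' eX']] := (spelling_epi ee, spelling_epi ee').
  have II' : I = I' by apply/spelling_inj/(prefix_inj (etrans (esym eX) eX') eI).
  by subst I'; rewrite (spelling_epi_unique ee ee') (spelling_strong_unique sm sm').
- move=> X Y f; have [I [e [m [ee sm ->]]]] := A2 ax f; rewrite im_lenE //.
  have [[s ->] [p ->]] := (spelling_epi ee, spelling_strong sm).
  rewrite !size_cat; split; first lia.
  by rewrite /pre /suf take_size_cat // size_cat addnK drop_size_cat.
(* The common prefix of [X] and suffix of [Y] spells an object [I] that is a quotient of [X] and a
   strong subobject of [Y]. *)
- move=> X Y r le eq.
  have [A [I [u [d [/[dup] [[_ ed _]] _ _ eI]]]]] :=
    spelling_extension_exists (esym (cat_take_drop r (spelling X))).
  have [I' [B [u' [d' [[su' _ _] eI' _]]]]] :=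
    spelling_extension_exists (esym (cat_take_drop (size (spelling Y) - r) (spelling Y))).
  have II' : I' = I by apply: spelling_inj; rewrite eI eI' -/(suf r _) -eq.
  subst I'; exists (u' ∘ d); rewrite im_lenE // eI size_takel //; lia.
- move=> X; rewrite -{1}[idm X]ccomp1m; apply: im_lenE.
    exact/iso_epi/idm_iso.
  exact/iso_strong/idm_iso.
- exact: im_len_comp.
Qed.

Lemma initial_label_arity (phi : derived_label t) : label_arity phi = 1.
Proof.
apply/card_eq_II; rewrite -(card_eql (label_arityE ax phi)) //.
by apply/card1_point; apply: t_init.
Qed.

End Pointed.

(** * Equivalence of the conditions *)

Lemma pointed_initial (C : category) (t : terminal_object C) :
  pointed C <-> is_initial (t : C).
Proof.
split=> [[X [Xi Xt]] Y|ti]; last first.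
  by exists (t : C); split=> // X; exists (bang t X) => g; apply: bang_eq.
have [[f fu] [a _]] := (Xi Y, Xt t); exists (f ∘ a) => g.
by rewrite -(fu (g ∘ bang t X)) -ccompA (bang_eq (bang t X ∘ a) (idm t)) ccompm1.
Qed.

Lemma arity1_pointed (C : category) (t : terminal_object C) :
  nine_axioms t -> (forall phi : derived_label t, label_arity phi = 1) -> pointed C.
Proof. by move=> ax ar1; apply/(pointed_initial t)/arity1_initial. Qed.

Lemma pointed_arity1 (C : category) (t : terminal_object C) :
  nine_axioms t -> pointed C -> forall phi : derived_label t, label_arity phi = 1.
Proof. by move=> ax /(pointed_initial t) ti phi; apply: initial_label_arity. Qed.

Lemma pointed_words (C : category) (t : terminal_object C) :
  nine_axioms t -> pointed C -> exists L : Type, isomorphic C (word_category L).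
Proof.
move=> ax /(pointed_initial t) ti; have [F _] := pointed_cat_iso ax ti.
by exists (derived_label t); split.
Qed.

(** Point sets are finite, so every object is an operation of some arity; if this is always one,
    every object has exactly one point and [t] is initial. *)
Lemma pointed_operations (C : category) (t : terminal_object C) :
  nine_axioms t -> pointed C <-> forall n (X : operation t n), n = 1.
Proof.
move=> ax; split=> [/(pointed_initial t) ti n [X /card_esym en]|ops].
  by apply/card_eq_II; apply: card_eq_trans en _; apply/card1_point; apply: ti.
apply/(pointed_initial t) => X; apply/card1_point.
have /finite_setP [n en] := finite_points ax X.
by have n1 := ops n (exist _ X en); rewrite n1 in en.
Qed.

Lemma free_operation_unary (Phi : Type) (ar : Phi -> nat) :
  (forall phi, ar phi = 1) <-> (forall n (x : free_operation ar n), n = 1).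
Proof.
split=> [ar1 n|free1 phi].
  elim=> // phi m _ m1; under eq_bigr do rewrite m1.
  by rewrite sum1_card card_ord ar1.
(* A single vertex [phi] with units on all its inputs has [ar phi] leaves. *)
have := free1 _ (FreeGraft (phi := phi) (fun=> FreeUnit ar)).
by rewrite sum1_card card_ord.
Qed.

Theorem theorem2p8 (C : category) :
  [/\ [<-> (exists t : terminal_object C, nine_axioms t) /\ pointed C;
           exists t : terminal_object C, nine_axioms t /\
             forall phi : derived_label t, label_arity phi = 1;
           exists L : Type, isomorphic C (word_category L)],
      forall t : terminal_object C, nine_axioms t ->
        [<-> pointed C;
             forall phi : derived_label t, label_arity phi = 1;
             exists L : Type, isomorphic C (word_category L);
             forall (n : nat) (X : operation t n), n = 1;
             forall (n : nat) (x : free_operation (@label_arity C t) n), n = 1]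
    & forall t : terminal_object C, nine_axioms t -> pointed C ->
        [/\ forall X : C, is_derived_label t X <-> complexity X = 1,
            exists F : cat_iso C (word_category (derived_label t)),
              forall phi : derived_label t, F (proj1_sig phi) = [:: phi]
          & forall (L : Type) (F : cat_iso C (word_category L)),
              (forall X : C, complexity X = size (F X)) /\
              exists2 g : L -> derived_label t, bijective g &
                forall l : L, F (proj1_sig (g l)) = [:: l]]].
Proof.
split=> [|t ax|t ax pt].
- split; [|split].
  + by move=> [[t ax] pt]; exists t; split=> //; apply: pointed_arity1.
  + by move=> [t [ax ar1]]; apply: pointed_words ax (arity1_pointed ax ar1).
  move=> [L [F]]; have [t] := word_terminal F.
  by split; [exists t; exact: word_nine_axioms F t|exact: word_pointed F].
- split; [|split; [|split; [|split]]].
  + exact: pointed_arity1.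
  + by move=> ar1; apply: pointed_words ax (arity1_pointed ax ar1).
  + by move=> [L [F]]; apply/pointed_operations => //; exact: word_pointed F.
  + by move=> /(pointed_operations ax) pt; apply/free_operation_unary/pointed_arity1.
  by move=> /free_operation_unary; apply: arity1_pointed.
have [F FE] := pointed_cat_iso ax (iffLR (pointed_initial t) pt); split.
- by move=> X; rewrite (word_complexity F); exact: word_label.
- by exists F.
by move=> L G; split; [exact: word_complexity|exact: word_letters].
Qed.
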